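(* For every $c\in(0,1]$, \[ \Pr(\hat L_n\le c\ln n)=n^{-K(c)+o(1)}\qquad(n\to\infty), \] where $K(c)=\frac{(1-c)^2}{8c}$.
   Context: $(B_t)_{t\ge0}$ is a standard Brownian motion and $\hat L_n=\int_1^nB_t^2/t^2\,dt$. *)

(* Defs.v *)
From HB Require Import structures.
From mathcomp Require Import all_boot all_order all_algebra.
From mathcomp Require Import all_classical all_reals all_analysis.
Set Implicit Arguments. Unset Strict Implicit. Unset Printing Implicit Defensive.
Import Order.TTheory GRing.Theory Num.Theory.
Import numFieldNormedType.Exports.
Local Open Scope classical_set_scope.
Local Open Scope ring_scope.

Definition brownian_motion {R : realType} {d : measure_display}
    {T : measurableType d} (P : probability T R) (B : R -> T -> R) : Prop :=
  [/\ (forall t, measurable_fun setT (B t)),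
      (forall w, B 0 w = 0),
      (forall w, {within `[0, +oo[, continuous (fun t => B t w)}),
      (forall s t, 0 <= s -> s < t -> forall A : set R, measurable A ->
         P [set w | A (B t w - B s w)] = normal_prob 0 (Num.sqrt (t - s)) A)
    & (forall (k : nat) (ts : nat -> R), 0 <= ts 0%N ->
         (forall i, (i < k)%N -> ts i < ts i.+1) ->
         forall A : nat -> set R, (forall i, measurable (A i)) ->
         P (\bigcap_(i in [set j | (j < k)%N])
               [set w | A i (B (ts i.+1) w - B (ts i) w)])
         = \big[*%E/1%E]_(i < k) P [set w | A i (B (ts i.+1) w - B (ts i) w)%R])].

Definition Lhat {R : realType} {T : Type} (B : R -> T -> R) (n : nat) (w : T) : R :=
  Rintegral lebesgue_measure `[1, n%:R] (fun t => (B t w) ^+ 2 / t ^+ 2).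

Definition Krate {R : realType} (c : R) : R := (1 - c) ^+ 2 / (8 * c).

(* Main.v *)
Require Import Defs.
From HB Require Import structures.
From mathcomp Require Import all_boot all_order all_algebra.
From mathcomp Require Import all_classical all_reals all_analysis.
From mathcomp Require Import measurable_realfun ring lra.
Import Order.TTheory GRing.Theory Num.Theory.
Import numFieldNormedType.Exports.
Local Open Scope classical_set_scope.
Local Open Scope ring_scope.

(** In logarithmic time [B_t / sqrt t] is a stationary Ornstein-Uhlenbeck process
    and [Lhat] is its energy up to time [ln n].  Along the geometric grid
    [t_i = n^(i/m)] the Laplace transform of the energy is an iterated Gaussian
    integral: integrating out one increment sends [exp (- a x^2 / 2)] to a
    function of the same form, with [a] updated by a discrete Riccati recursion.
    Supersolutions and telescoping for that recursion, followed by [m -> oo],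
    give, for [lam = b (1 + b) / 2] and up to factors depending only on [b],
    [E exp (- lam Lhat) = n^(- b / 2)].  The upper bound on the probability is
    Markov's inequality at [b = (1 - c) / (2 c)].  For the lower bound, the
    Laplace transforms at two neighbouring values of [b] show that the measure
    tilted by [exp (- lam Lhat)] concentrates on a window just below [c ln n],
    where the density is known up to [n^o(1)]. *)

(** * Independence of an increment from its past, in integral form *)

Lemma integral_indep (R : realType) d (T : measurableType d) d1
    (S1 : measurableType d1) d2 (S2 : measurableType d2)
    (P : probability T R) (nu : probability S2 R)
    (Y : T -> S1) (Z : T -> S2) (f : S1 * S2 -> \bar R) :
  measurable_fun setT Y -> measurable_fun setT Z ->
  (forall A C, measurable A -> measurable C ->
     P (Y @^-1` A `&` Z @^-1` C) = (P (Y @^-1` A) * nu C)%E) ->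
  measurable_fun setT f -> (forall x, (0 <= f x)%E) ->
  (\int[P]_w f (Y w, Z w) = \int[P]_w \int[nu]_z f (Y w, z))%E.
Proof.
move=> mY mZ ind mf f0.
have mYZ : measurable_fun setT (fun w => (Y w, Z w)) by exact/measurable_fun_pair.
pose mYp := isMeasurableFun.Build _ _ _ _ _ mY.
pose Yp : {mfun T >-> S1} := HB.pack Y mYp.
pose mYZp := isMeasurableFun.Build _ _ _ _ _ mYZ.
pose YZp : {mfun T >-> (S1 * S2)%type} := HB.pack (fun w => (Y w, Z w)) mYZp.
pose m1 : probability S1 R := distribution P Yp.
pose m : probability (S1 * S2)%type R := distribution P YZp.
(* The joint law of [Y] and [Z] agrees with the product measure on rectangles, hence everywhere;
   Tonelli then gives the iterated integral. *)
have mE : forall X, measurable X -> (m1 \x nu)%E X = m X.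
  by apply: product_measure_unique => A C mA mC; rewrite /m /m1 /= /distribution /pushforward -ind.
transitivity (\int[m]_z f z)%E.
  by rewrite ge0_integral_distribution.
rewrite (eq_measure_integral (m1 \x nu)%E); last by move=> A mA _; have := mE A mA.
rewrite fubini_tonelli1//= ge0_integral_distribution//.
  exact: measurable_fun_fubini_tonelli_F.
by move=> y; apply: integral_ge0.
Qed.

Section past_increments.
Context {R : realType} {d : measure_display} {T : measurableType d}.
Variables (P : probability T R) (D : nat -> T -> R) (k : nat).
Hypothesis mD : forall i, measurable_fun setT (D i).
Hypothesis indD : forall j, forall A : nat -> set R, (forall i, measurable (A i)) ->
  P (\bigcap_(i in [set i | (i < j)%N]) D i @^-1` A i) =
  (\big[*%E/1%E]_(i < j) P (D i @^-1` A i))%E.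

(** A pi-system generating the sigma-algebra of the first [k] increments. Putting that sigma-algebra
    on [T] itself avoids handling vectors of increments. *)
Definition past_cylinders : set (set T) :=
  [set E | exists2 A : nat -> set R, (forall i, measurable (A i)) &
    E = \bigcap_(i in [set j | (j < k)%N]) D i @^-1` A i].

Let mDA i (A : set R) : measurable A -> measurable (D i @^-1` A).
Proof. by move=> mA; rewrite -[_ @^-1` _]setTI; exact: mD. Qed.

Lemma past_cylinders_measurable : past_cylinders `<=` measurable.
Proof.
move=> _ [A mA ->]; apply: fin_bigcap_measurable => [|i _]; first exact: finite_II.
exact: mDA.
Qed.

Lemma sigma_past_measurable : <<s past_cylinders >> `<=` measurable.
Proof.
apply: smallest_sub; last exact: past_cylinders_measurable.
exact: sigma_algebra_measurable.
Qed.

Lemma past_cylinders_setI_closed : setI_closed past_cylinders.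
Proof.
move=> _ _ [A mA ->] [C mC ->]; exists (fun i => A i `&` C i).
  by move=> i; exact: measurableI.
by rewrite -bigcapI.
Qed.

(** For fixed [C] both sides are finite measures in [E]. They agree on the cylinders, a pi-system,
    hence on the sigma-algebra generated by it. *)
Lemma sigma_past_indep E (C : set R) : <<s past_cylinders >> E -> measurable C ->
  P (E `&` D k @^-1` C) = (P E * P (D k @^-1` C))%E.
Proof.
move=> sE mC; have mDC := mDA k C mC.
have pC : (0 <= fine (P (D k @^-1` C)))%R by rewrite fine_ge0.
pose m1 := mrestr P mDC.
pose m2 := mscale (NngNum pC) P.
suff : m1 E = m2 E.
  by rewrite /m1 /m2 /mrestr /mscale/= fineK ?fin_num_measure// muleC.
apply: (@g_sigma_algebra_measure_unique _ _ _ past_cylinders _ (fun=> setT)) => //.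
- exact: past_cylinders_measurable.
- move=> _; exists (fun=> setT) => //; apply/seteqP; split => // x _ i _ //.
- by rewrite bigcup_const//; exists 0.
- exact: past_cylinders_setI_closed.
- move=> _ [A mA ->]; rewrite /m1 /m2 /mrestr /mscale/=.
  (* Inserting [C] as the constraint at index [k] gives a cylinder of length [k.+1], to which [indD]
     applies. *)
  pose A' i := if i == k then C else A i.
  have mA' i : measurable (A' i) by rewrite /A'; case: ifP.
  transitivity (P (\bigcap_(i in [set i | (i < k.+1)%N]) D i @^-1` A' i)).
    congr (P _); apply/seteqP; split => x /=.
      move=> [h1 h2] i /=; rewrite ltnS leq_eqVlt => /predU1P[->|ik].
        by rewrite /A' eqxx.
      by rewrite /A' (ltn_eqF ik); exact: h1.
    move=> h; split; last by have := h k (ltnSn k); rewrite /A' eqxx.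
    by move=> i /= ik; have := h i (ltnW ik); rewrite /A' (ltn_eqF ik).
  rewrite indD// big_ord_recr/= /A' eqxx muleC.
  rewrite [X in _ = (X * _)%E](_ : _ = P (D k @^-1` C)); last by rewrite /= fineK ?fin_num_measure.
  congr (_ * _)%E; apply: eq_trans (esym (indD k A mA)); apply: eq_bigr => i _.
  by rewrite (ltn_eqF (ltn_ord i)).
- move=> _; apply: (@le_lt_trans _ _ 1%E); last exact: ltry.
  by apply: probability_le1; exact: measurableI.
Qed.

Lemma measurable_past i : (i < k)%N ->
  measurable_fun setT (D i : g_sigma_algebraType past_cylinders -> R).
Proof.
move=> ik _ C mC; rewrite setTI; apply: sub_sigma_algebra.
exists (fun j => if j == i then C else setT); first by move=> j; case: ifP.
apply/seteqP; split => x /=.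
  by move=> Cx j _ /=; case: eqP => // ->.
by move/(_ i ik) => /=; rewrite eqxx.
Qed.

(** The identity, read as a map from [T] to [T] with the coarser sigma-algebra of the past, serves
    as the first variable; [f] may thus depend on the whole past at once. *)
Lemma integral_past_indep (nu : probability (measurableTypeR R) R)
    (f : g_sigma_algebraType past_cylinders * measurableTypeR R -> \bar R) :
  (forall C, measurable C -> P (D k @^-1` C) = nu C) ->
  measurable_fun setT f -> (forall x, (0 <= f x)%E) ->
  (\int[P]_w f (w, D k w) = \int[P]_w \int[nu]_z f (w, z))%E.
Proof.
move=> Dnu mf f0.
apply: (@integral_indep _ _ _ _ (g_sigma_algebraType past_cylinders) _ _ P nu id (D k)) => //.
- by move=> _ A mA; rewrite setTI; exact: sigma_past_measurable.
- by move=> _ C mC; apply: mD.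
- by move=> A C mA mC; rewrite sigma_past_indep// Dnu.
Qed.

End past_increments.

(** * Gaussian integrals *)

Lemma integral_normal_prob (R : realType) (m s : R) (f : R -> R) :
  measurable_fun setT f -> (forall x, 0 <= f x <= 1) ->
  (\int[normal_prob m s]_x (f x)%:E =
   \int[lebesgue_measure]_x (f x * normal_pdf m s x)%:E)%E.
Proof.
move=> mf f01; set mu := lebesgue_measure.
have mfE : measurable_fun setT (EFin \o f) by exact/measurable_EFinP.
have intf : (normal_prob m s).-integrable setT (EFin \o f).
  apply: (@le_integrable _ _ _ _ _ _ _ (cst 1%E)) => //=.
    move=> x _; have /andP[? ?] := f01 x.
    by rewrite lee_fin normr1 ger0_norm.
  exact: finite_measure_integrable_cst.
(* After the change of measure, the Radon-Nikodym derivative is identified almost everywhere with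
   the density, both having the same integral over every measurable set. *)
rewrite -(Radon_Nikodym_change_of_variables (normal_prob_dominates m s))//=.
under [RHS]eq_integral do rewrite EFinM.
apply: ae_eq_integral => //.
- apply: emeasurable_funM => //; apply: (measurable_int mu).
  by apply: Radon_Nikodym_integrable; exact: normal_prob_dominates.
- apply: emeasurable_funM => //; apply/measurable_EFinP.
  exact: measurable_normal_pdf.
- apply: ae_eqe_mul2l => /=.
  rewrite Radon_NikodymE//=; first exact: normal_prob_dominates.
  move=> abmu; case: cid => /= h [h1 h2 h3].
  apply: integral_ae_eq => //=.
  + by apply/measurable_EFinP; exact: measurable_normal_pdf.
  + by move=> E E01 mE; rewrite -h3.
Qed.

Lemma normal_gaussian_integral (R : realType) (s a y : R) : 0 < s -> 0 <= a ->
  (\int[normal_prob 0 s]_z (expR (- (a * (y + z) ^+ 2 / 2)))%:E =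
   ((Num.sqrt (1 + a * s ^+ 2))^-1 *
    expR (- (a * y ^+ 2 / (2 * (1 + a * s ^+ 2)))))%:E)%E.
Proof.
move=> s0 a0; set v := 1 + a * s ^+ 2.
have v1 : 1 <= v by rewrite lerDl mulr_ge0 ?sqr_ge0.
have v0 : 0 < v by lra.
have sv0 : 0 < Num.sqrt v by rewrite sqrtr_gt0.
have sv2 : Num.sqrt v ^+ 2 = v by rewrite sqr_sqrtr ?ltW.
rewrite integral_normal_prob; last 2 first.
- apply: measurableT_comp => //; apply: measurableT_comp => //.
  apply: measurable_funM => //; apply: measurable_funM => //.
  by apply: measurable_funX; exact: measurable_funD.
- move=> x; rewrite expR_ge0/= -[leRHS]expR0 ler_expR oppr_le0.
  by rewrite divr_ge0// mulr_ge0// sqr_ge0.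
(* Completing the square: the integrand times the centred density is [C] times the density of the
   normal law of mean [m'] and standard deviation [s'], whose integral is 1. *)
pose s' := s / Num.sqrt v; pose m' := - (a * y * s ^+ 2 / v).
have s'0 : 0 < s' by rewrite divr_gt0.
pose C := (Num.sqrt v)^-1 * expR (- (a * y ^+ 2 / (2 * v))).
transitivity (\int[lebesgue_measure]_x (C%:E * (normal_pdf m' s' x)%:E))%E.
  apply: eq_integral => x _; rewrite -EFinM; congr EFin.
  rewrite !normal_pdfE ?gt_eqF// /C /normal_fun subr0.
  have pk : normal_peak s = (Num.sqrt v)^-1 * normal_peak s'.
    rewrite /normal_peak -invfM; congr (_^-1).
    rewrite -sqrtrM ?(ltW v0)//; congr Num.sqrt.
    rewrite /s' expr_div_n sv2 [RHS]mulrnAr; congr (_ *+ 2).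
    by rewrite [RHS]mulrA; congr (_ * _); rewrite mulrCA divff ?mulr1 ?gt_eqF.
  rewrite pk; set p := normal_peak s'; set w := (Num.sqrt v)^-1.
  set e1 := expR _; set e2 := expR _; set e3 := expR _; set e4 := expR _.
  suff e12 : e1 * e2 = e3 * e4.
    rewrite (_ : e1 * _ = w * p * (e1 * e2)); last by ring.
    by rewrite e12; ring.
  rewrite /e1 /e2 /e3 /e4 -!expRD; congr expR.
  rewrite /s' /m' expr_div_n sv2 /v; field.
  by rewrite (gt_eqF s0) gt_eqF.
rewrite ge0_integralZl//=.
- by rewrite integral_normal_pdf mule1.
- by apply/measurable_EFinP; exact: measurable_normal_pdf.
- by move=> x _; rewrite lee_fin normal_pdf_ge0.
- by rewrite lee_fin mulr_ge0 ?invr_ge0 ?sqrtr_ge0 ?expR_ge0.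
Qed.

(** * The discrete Riccati recursion *)

(** Integrating out the last increment turns the weight [a] at one grid point into
    [a * (1 - q) / (1 + a * q)] at the previous one, where the energy adds [2 * lam * q]. Fixed
    points solve [a * (1 + a) = 2 * lam * (1 + a * q)]. *)
Definition riccati {R : realType} (lam q a : R) :=
  2 * lam * q + a * (1 - q) / (1 + a * q).

Section riccati_recursion.
Context {R : realType}.
Variables (lam q g : R).
Hypotheses (lam0 : 0 <= lam) (q01 : 0 < q < 1) (g0 : 0 <= g).
Hypothesis g_super : 2 * lam * (1 + g * q) <= g * (1 + g).

Let q0 : 0 < q. Proof. by case/andP: q01. Qed.
Let q1 : q < 1. Proof. by case/andP: q01. Qed.
Let den a : 0 <= a -> 0 < 1 + a * q.
Proof. by move=> a0; rewrite ltr_pwDl// mulr_ge0// ltW. Qed.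

Let riccatiE a : 0 <= a ->
  riccati lam q a = a + q * (2 * lam - a * (1 + a) / (1 + a * q)).
Proof.
by move=> a0; rewrite /riccati; field; apply: lt0r_neq0; have := den _ a0; lra.
Qed.

Lemma riccati_ge0 a : 0 <= a -> 0 <= riccati lam q a.
Proof.
move=> a0; rewrite addr_ge0//; first by rewrite !mulr_ge0// ltW.
apply: divr_ge0; last exact/ltW/den.
by rewrite mulr_ge0// subr_ge0 ltW.
Qed.

(** The map is increasing on nonnegative [a] since [q < 1], and [g_super] says exactly that it sends
    [g] to at most [g], that is, [g] is a supersolution. *)
Lemma riccati_le a : 0 <= a <= g -> riccati lam q a <= g.
Proof.
move=> /andP[a0 ag]; apply: (@le_trans _ _ (riccati lam q g)).
  rewrite lerD2l ler_pdivrMr ?den// mulrAC ler_pdivlMr ?den//.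
  rewrite -subr_ge0 (_ : _ - _ = (g - a) * (1 - q)); last by ring.
  by rewrite mulr_ge0// subr_ge0// ltW.
rewrite riccatiE// gerDl pmulr_rle0// subr_le0 ler_pdivlMr ?den//.
Qed.

(** The nonlinear term [a * (1 + a) / (1 + a * q)] is at most [(1 + g) * a]. The resulting bound is
    linear in [a], so it can be telescoped. *)
Lemma riccati_incr a : 0 <= a <= g ->
  a + q * (2 * lam - (1 + g) * a) <= riccati lam q a.
Proof.
move=> /andP[a0 ag]; rewrite riccatiE// lerD2l ler_pM2l// lerD2l lerN2.
rewrite ler_pdivrMr ?den//.
have h1 : a * a <= a * g by rewrite ler_wpM2l.
have h2 : 0 <= a * (1 + g) * (a * q) by rewrite !mulr_ge0 ?addr_ge0// ltW.
lra.
Qed.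

Lemma iter_riccati_itv j : 0 <= iter j (riccati lam q) 0 <= g.
Proof.
elim: j => [|j IH] /=; first by rewrite lexx.
by rewrite riccati_le// riccati_ge0//; case/andP: IH.
Qed.

(* Summing the increments of the recursion bounds the sum of its terms from
   below without solving it. *)
Lemma sum_iter_riccati_ge m :
  2 * lam * q * m%:R - g <= (1 + g) * (q * \sum_(j < m) iter j (riccati lam q) 0).
Proof.
suff : 2 * lam * q * m%:R - iter m (riccati lam q) 0 <=
    (1 + g) * (q * \sum_(j < m) iter j (riccati lam q) 0).
  by have /andP[_] := iter_riccati_itv m; lra.
elim: m => [|m IH]; first by rewrite big_ord0/=; lra.
have := riccati_incr _ (iter_riccati_itv m).
rewrite big_ord_recr/= -natr1; move: IH.
set a := iter m _ 0; set b := riccati _ _ a; set s := \sum_(_ < _) _; lra.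
Qed.

Let x_ j := iter j (riccati lam q) 0 * q.
Let x_itv j : 0 <= x_ j <= g * q.
Proof.
have /andP[a0 ag] := iter_riccati_itv j.
by rewrite /x_ mulr_ge0 ?(ltW q0)//= ler_wpM2r// ltW.
Qed.

(** Each factor is bounded separately, by [1 + x <= expR x] and [x <= g * q]. *)
Lemma prod_riccati_ge m :
  expR (- (g * q * m%:R / 2)) <=
  \prod_(j < m) (Num.sqrt (1 + iter j (riccati lam q) 0 * q))^-1.
Proof.
elim: m => [|m IH]; first by rewrite big_ord0 mulr0 mul0r oppr0 expR0.
rewrite big_ord_recr/= -natr1 mulrDr mulr1 mulrDl opprD expRD.
apply: ler_pM; rewrite ?expR_ge0//.
have /andP[x0 xg] := x_itv m; rewrite -/(x_ m).
rewrite expRN lef_pV2 ?posrE ?sqrtr_gt0 ?expR_gt0 ?ltr_pwDl//.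
rewrite -[leRHS]ger0_norm ?expR_ge0// -sqrtr_sqr ler_wsqrtr//.
rewrite -expRM_natl mulrC divfK// (le_trans _ (expR_ge1Dx _))//.
by rewrite lerD2l.
Qed.

(** For [0 <= x <= g * q] one has [expR (x / (1 + g * q)) <= 1 + x], so the product is controlled by
    the sum of the iterates, which [sum_iter_riccati_ge] bounds from below. *)
Lemma prod_riccati_le m :
  \prod_(j < m) (Num.sqrt (1 + iter j (riccati lam q) 0 * q))^-1 <=
  expR (- ((2 * lam * q * m%:R - g) / (2 * (1 + g) * (1 + g * q)))).
Proof.
have gq : 0 < 1 + g * q by exact: den.
have g1 : 0 < 1 + g by rewrite ltr_pwDl.
apply: (@le_trans _ _ (expR (- ((\sum_(j < m) x_ j) / (2 * (1 + g * q)))))).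
  elim: m => [|m IH]; first by rewrite !big_ord0 mul0r oppr0 expR0.
  rewrite !big_ord_recr/= mulrDl opprD expRD.
  apply: ler_pM => //; rewrite ?invr_ge0 ?sqrtr_ge0 ?prodr_ge0//.
  have /andP[x0 xg] := x_itv m; rewrite -/(x_ m); set x := x_ m in x0 xg *.
  have x1 : 0 < 1 + x by rewrite ltr_pwDl.
  rewrite expRN lef_pV2 ?posrE ?sqrtr_gt0 ?expR_gt0//.
  rewrite -[leLHS]ger0_norm ?expR_ge0// -sqrtr_sqr ler_wsqrtr//.
  rewrite -expRM_natl (_ : _ * _ = x / (1 + g * q)); last first.
    by field; rewrite ?(gt_eqF g1)//=; apply: lt0r_neq0; move: gq; lra.
  rewrite -[leRHS]invrK -[leLHS]invrK lef_pV2 ?posrE ?invr_gt0 ?expR_gt0//.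
  rewrite -expRN (le_trans _ (expR_ge1Dx _))//.
  rewrite (_ : 1 - _ = (1 + g * q - x) / (1 + g * q)); last first.
    by field; apply: lt0r_neq0; move: gq; lra.
  rewrite -[X in X <= _]mul1r ler_pdivrMr// mulrAC ler_pdivlMr// mul1r.
  have : 0 <= x * (g * q - x) by rewrite mulr_ge0// subr_ge0.
  lra.
rewrite ler_expR lerN2 ler_pdivrMr ?mulr_gt0// mulrC.
rewrite (_ : (\sum_(j < m) x_ j) / _ * _ = (1 + g) * \sum_(j < m) x_ j); last first.
  by field; rewrite ?(gt_eqF g1)//=; apply: lt0r_neq0; move: gq; lra.
rewrite /x_ -mulr_suml; have := sum_iter_riccati_ge m; lra.
Qed.

End riccati_recursion.

(** * Laplace transform of the discretised energy on a geometric grid *)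

Section brownian_grid.
Context {R : realType} {d : measure_display} {T : measurableType d}.
Variables (P : probability T R) (B : R -> T -> R) (rho lam : R).
Hypotheses (BM : brownian_motion P B) (rho1 : 1 < rho) (lam0 : 0 <= lam).

(** [q / rho ^+ i] is the integral of [t ^- 2] over the cell from [rho ^+ i] to [rho ^+ i.+1], so
    [q * X2 i] is the energy of the cell with [B] frozen at its left end. *)
Let q := 1 - rho^-1.
Let X2 i w := (B (rho ^+ i) w) ^+ 2 / rho ^+ i.
(** The time 0 is put in front of the grid, which shifts indices by one: [D 0] is the value at time
    1, and [B (rho ^+ i)] is the sum of the first [i.+1] increments. *)
Let ts i : R := if i is j.+1 then rho ^+ j else 0.
Let D i w := B (ts i.+1) w - B (ts i) w.

Let rho0 : 0 < rho. Proof. by rewrite (lt_trans _ rho1). Qed.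
Let rhoX i : 0 < rho ^+ i. Proof. exact: exprn_gt0. Qed.
Let q0 : 0 < q. Proof. by rewrite subr_gt0 invf_lt1. Qed.

Let ts_lt i : ts i < ts i.+1.
Proof.
by case: i => [|i] /=; rewrite ?expr0// exprS ltr_pMl.
Qed.

Let mD i : measurable_fun setT (D i).
Proof. by have [mB _ _ _ _] := BM; exact: measurable_funB. Qed.

Let indD j (A : nat -> set R) : (forall i, measurable (A i)) ->
  P (\bigcap_(i in [set i | (i < j)%N]) D i @^-1` A i) =
  (\big[*%E/1%E]_(i < j) P (D i @^-1` A i))%E.
Proof. by move=> mA; have [_ _ _ _ ind] := BM; exact: (ind j ts). Qed.

Let lawD i (C : set R) : measurable C ->
  P (D i @^-1` C) = normal_prob 0 (Num.sqrt (ts i.+1 - ts i)) C.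
Proof.
move=> mC; have [_ _ _ law _] := BM; apply: (law (ts i) (ts i.+1)) => //.
by case: i => //= i; exact: ltW.
Qed.

Let B_sum i w : B (rho ^+ i) w = \sum_(j < i.+1) D j w.
Proof.
have [_ B0 _ _ _] := BM.
elim: i => [|i IH]; first by rewrite big_ord_recl big_ord0 addr0 /D /= B0 subr0.
by rewrite big_ord_recr/= -IH /D/= addrCA subrr addr0.
Qed.

Let mB_past k i : (i < k)%N -> measurable_fun setT
  (B (rho ^+ i) : g_sigma_algebraType (past_cylinders D k) -> R).
Proof.
move=> ik; rewrite (_ : B (rho ^+ i) = fun w => \sum_(j < i.+1) D j w); last first.
  by apply/funext => w; exact: B_sum.
apply: measurable_sum => j; apply: measurable_past.
by rewrite (leq_trans (ltn_ord j)).
Qed.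

(** The extra weight [a] at the last point makes the family stable under integrating out the last
    increment; the transform of the energy alone is the case [a = 0]. *)
Definition grid_laplace k a : \bar R :=
  (\int[P]_w (expR (- (lam * q * \sum_(i < k) X2 i w) - a * X2 k w / 2))%:E)%E.

Lemma grid_laplace0 a : 0 <= a ->
  grid_laplace 0 a = ((Num.sqrt (1 + a))^-1)%:E.
Proof.
move=> a0.
pose f (x : g_sigma_algebraType (past_cylinders D 0) * measurableTypeR R) : \bar R :=
  (expR (- (a * (0 + x.2) ^+ 2 / 2)))%:E.
transitivity (\int[P]_w f (w, D 0 w))%E.
  apply: eq_integral => w _; rewrite /f big_ord0 /X2 B_sum expr0.
  rewrite big_ord_recl big_ord0 addr0 add0r; congr (expR _)%:E => /=.
  by rewrite mulr0 oppr0 add0r divr1.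
rewrite (@integral_past_indep _ _ _ P D 0 mD indD (normal_prob 0 1)) => //=.
- under eq_integral do rewrite /f/= normal_gaussian_integral//.
  rewrite integral_cst//= probability_setT mule1; congr EFin.
  by rewrite expr1n mulr1 expr0n mulr0 mul0r oppr0 expR0 mulr1.
- by move=> C mC; rewrite lawD//= expr0 subr0 sqrtr1.
- apply/measurable_EFinP; apply: measurableT_comp => //.
  apply: measurableT_comp => //; apply: measurable_funM => //.
  apply: measurable_funM => //; apply: measurable_funX.
  exact: measurable_funD.
- by move=> x; rewrite lee_fin expR_ge0.
Qed.

Lemma grid_laplaceS k a : 0 <= a -> grid_laplace k.+1 a =
  (((Num.sqrt (1 + a * q))^-1)%:E *
   grid_laplace k (riccati lam q a))%E.
Proof.
move=> a0.
have aq : 0 < 1 + a * q by rewrite ltr_wpDr// mulr_ge0// ltW.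
pose g w := lam * q * \sum_(i < k.+1) X2 i w.
(* The value at [rho ^+ k.+1] is split into the value at [rho ^+ k], a function of the past, and the
   independent increment [D k.+1]. *)
pose f (x : g_sigma_algebraType (past_cylinders D k.+1) * measurableTypeR R) : \bar R :=
  (expR (- g x.1) *
   expR (- (a / rho ^+ k.+1 * (B (rho ^+ k) x.1 + x.2) ^+ 2 / 2)))%:E.
transitivity (\int[P]_w f (w, D k.+1 w))%E.
  apply: eq_integral => w _; rewrite /f -expRD; congr (expR _)%:E => /=.
  rewrite -/(g w); congr (_ - _); rewrite /X2 [D _ _]/(_ - _) addrCA subrr addr0.
  move: (rhoX k.+1); set r := rho ^+ k.+1 => r0.
  by field; rewrite gt_eqF.
pose s := Num.sqrt (ts k.+2 - ts k.+1).
have s0 : 0 < s by rewrite sqrtr_gt0 subr_gt0.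
(* Multiplied by the coefficient [a / rho ^+ k.+1], this variance leaves exactly [a * q]. *)
have s2 : s ^+ 2 = rho ^+ k.+1 * q.
  rewrite sqr_sqrtr ?subr_ge0 ?ltW// /q mulrBr mulr1 /= exprS.
  by congr (_ - _); rewrite mulrC mulKf ?gt_eqF.
rewrite (@integral_past_indep _ _ _ P D k.+1 mD indD (normal_prob 0 s)) => //=.
- have mh : measurable_fun setT (fun w =>
      (expR (- (lam * q * \sum_(i < k) X2 i w) -
        riccati lam q a * X2 k w / 2))%:E).
    have [mB _ _ _ _] := BM.
    have mX i : measurable_fun setT (X2 i).
      by apply: measurable_funM => //; apply: measurable_funX.
    apply/measurable_EFinP; apply: measurableT_comp => //.
    apply: measurable_funB; last by do 2 apply: measurable_funM => //.
    apply: measurableT_comp => //; apply: measurable_funM => //.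
    exact: measurable_sum.
  have c0 : (0 <= ((Num.sqrt (1 + a * q))^-1)%:E)%E.
    by rewrite lee_fin invr_ge0 sqrtr_ge0.
  rewrite -ge0_integralZl//.
  apply: eq_integral => w _; rewrite /f/=.
  under eq_integral do rewrite EFinM.
  rewrite ge0_integralZl//=; last first.
    apply/measurable_EFinP; apply: measurableT_comp => //.
    apply: measurableT_comp => //; apply: measurable_funM => //.
    apply: measurable_funM => //; apply: measurable_funX.
    exact: measurable_funD.
  rewrite normal_gaussian_integral//; last by apply: divr_ge0 => //; exact/ltW/rhoX.
  rewrite s2 mulrA divfK ?gt_eqF// -!EFinM; congr EFin.
  rewrite mulrCA; congr (_ * _); rewrite -expRD; congr expR.
  rewrite /g big_ord_recr/=.
  have -> : X2 k w = (B (rho ^+ k) w) ^+ 2 / rho ^+ k by [].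
  rewrite /riccati /q [rho ^+ k.+1]exprS.
  have ar : 0 < rho + a * (rho - 1) by rewrite ltr_pwDl// mulr_ge0// subr_ge0 ltW.
  move: (rhoX k); set r := rho ^+ k => r0.
  by field; rewrite !gt_eqF.
- by move=> C mC; rewrite lawD.
(* Measurability has to hold for the sigma-algebra of the past, so it goes through [mB_past]. *)
- pose T' := g_sigma_algebraType (past_cylinders D k.+1).
  have mB i : (i < k.+1)%N -> measurable_fun setT (B (rho ^+ i) : T' -> R).
    exact: mB_past.
  have mg : measurable_fun setT (g : T' -> R).
    apply: measurable_funM => //; apply: measurable_sum => i.
    by apply: measurable_funM => //; apply: measurable_funX; exact: mB.
  apply/measurable_EFinP; apply: measurable_funM.
    apply: measurableT_comp => //; apply: measurableT_comp => //.
    exact: (measurableT_comp mg measurable_fst).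
  apply: measurableT_comp => //.
  apply: measurableT_comp => //; apply: measurable_funM => //.
  apply: measurable_funM => //; apply: measurable_funX.
  apply: measurable_funD => //.
  exact: (measurableT_comp (mB k (ltnSn k)) measurable_fst).
- by move=> x; rewrite lee_fin mulr_ge0 ?expR_ge0.
Qed.

(** Induction on [m] for all [a] at once, as each step changes the weight. The last factor comes
    from the standard normal value at time 1. *)
Lemma grid_laplaceE m a : 0 <= a -> grid_laplace m a =
  (\prod_(j < m) (Num.sqrt (1 + iter j (riccati lam q) a * q))^-1 *
   (Num.sqrt (1 + iter m (riccati lam q) a))^-1)%:E.
Proof.
elim: m a => [|m IH] a a0; first by rewrite big_ord0 mul1r grid_laplace0.
have q1 : q < 1 by rewrite gtrBl invr_gt0.
rewrite grid_laplaceS// IH; last by apply: riccati_ge0 => //; rewrite q0.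
rewrite -EFinM big_ord_recl -mulrA; congr (_ * (_ * _))%:E.
  by apply: eq_bigr => j _; rewrite -iterSr.
by rewrite -iterSr.
Qed.

Lemma grid_laplace_ge m g : 0 <= g ->
  2 * lam * (1 + g * q) <= g * (1 + g) ->
  (((Num.sqrt (1 + g))^-1 * expR (- (g * q * m%:R / 2)))%:E <=
   grid_laplace m 0)%E.
Proof.
move=> g0 gs; have q01 : 0 < q < 1 by rewrite q0 gtrBl invr_gt0.
rewrite grid_laplaceE// lee_fin mulrC.
have /andP[i0 ig] := iter_riccati_itv _ _ _ lam0 q01 g0 gs m.
apply: ler_pM; rewrite ?expR_ge0 ?invr_ge0 ?sqrtr_ge0//.
  exact: prod_riccati_ge.
rewrite lef_pV2 ?posrE ?sqrtr_gt0 ?ltr_pwDl// ler_wsqrtr//.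
by rewrite lerD2l.
Qed.

Lemma grid_laplace_le m g : 0 <= g ->
  2 * lam * (1 + g * q) <= g * (1 + g) ->
  (grid_laplace m 0 <=
   (expR (- ((2 * lam * q * m%:R - g) / (2 * (1 + g) * (1 + g * q)))))%:E)%E.
Proof.
move=> g0 gs; have q01 : 0 < q < 1 by rewrite q0 gtrBl invr_gt0.
rewrite grid_laplaceE// lee_fin -[leRHS]mulr1.
have /andP[i0 ig] := iter_riccati_itv _ _ _ lam0 q01 g0 gs m.
apply: ler_pM; rewrite ?invr_ge0 ?sqrtr_ge0//.
- by apply: prodr_ge0 => j _; rewrite invr_ge0 sqrtr_ge0.
- exact: prod_riccati_le.
- rewrite invf_le1 ?sqrtr_gt0 ?ltr_pwDl//.
  by rewrite -[leLHS]sqrtr1 ler_wsqrtr// lerDl.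
Qed.

End brownian_grid.

(** * Convergence of geometric Riemann sums for the weight [t ^- 2] *)

Section riemann_sums.
Context {R : realType}.
Notation mu := (@lebesgue_measure R).

Lemma segment_unif_continuous (f : R -> R) (a b : R) :
  {within `[a, b], continuous f} ->
  forall e, 0 < e -> exists2 del, 0 < del &
    forall x y, x \in `[a, b] -> y \in `[a, b] -> `|x - y| < del ->
      `|f x - f y| < e.
Proof.
move=> cf e e0.
have e20 : 0 < e / 2 by rewrite divr_gt0.
pose Q (del x : R) := forall y, x \in `[a, b] -> y \in `[a, b] ->
  `|x - y| < del -> `|f x - f y| < e.
have /compact_near_coveringP cov := @segment_compact R a b.
(* Heine-Cantor: compactness, as a near-covering property, makes the local estimates hold on the
   whole segment for all small [del]. *)
have : \forall del \near 0^'+, `[a, b]%classic `<=` Q del.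
  apply: (cov _ (0^'+) Q) => x xab.
  move/subspace_continuousP : cf => /(_ x xab) /cvgrPdist_lt /(_ _ e20).
  rewrite near_withinE => -[del /= del0 Hd].
  exists (ball x (del / 2), [set e' | 0 < e' < del / 2]).
    split => /=; first by apply: nbhsx_ballx; rewrite divr_gt0.
    near=> z; apply/andP; split; near: z; first exact: nbhs_right_gt.
    by apply: nbhs_right_lt; rewrite divr_gt0.
  move=> [x' d'] /= [bx' /andP[d'0 d'l]] y x'ab yab xy.
  have h1 : `|f x - f x'| < e / 2.
    apply: Hd => //; rewrite /ball/= in bx' *.
    by rewrite (lt_trans bx')// ltr_pdivrMr// ltr_pMr// ltr1n.
  have h2 : `|f x - f y| < e / 2.
    apply: Hd => //; rewrite /ball/= in bx' *.
    rewrite -(subrK x' x) -addrA (le_lt_trans (ler_normD _ _))//.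
    rewrite [ltRHS](splitr del) ltrD// (lt_trans xy)//.
  rewrite -(subrK (f x) (f x')) -addrA (le_lt_trans (ler_normD _ _))//.
  by rewrite [ltRHS](splitr e) ltrD// distrC.
(* The estimate holds for every positive radius below [del]; half of [del] is one. *)
case=> del /= del0 Hd; exists (del / 2); first by rewrite divr_gt0.
move=> x y xab yab xy; apply: (Hd (del / 2)) => //=.
- by rewrite /ball/= sub0r normrN gtr0_norm ?divr_gt0// ltr_pdivrMr// ltr_pMr// ltr1n.
- by rewrite divr_gt0.
Unshelve. all: end_near. Qed.

Lemma continuous_invsq (a b c : R) : 0 < a ->
  {within `[a, b], continuous (fun t => c / t ^+ 2)}.
Proof.
move=> a0; apply: continuous_in_subspaceT => x.
rewrite inE/= in_itv/= => /andP[ax xb].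
apply: cvgM; first exact: cvg_cst.
apply: cvgV; first by rewrite expf_neq0// gt_eqF// (lt_le_trans a0).
by apply: exprn_continuous.
Qed.

Lemma Rintegral_invsq (a b c : R) : 0 < a -> a < b ->
  \int[mu]_(t in `[a, b]) (c / t ^+ 2) = c * (a^-1 - b^-1).
Proof.
move=> a0 ab; rewrite /Rintegral.
have dF (x : R) : 0 < x -> is_derive x 1 (fun t : R => - c * t^-1) (c / x ^+ 2).
  move=> x0; have x00 : x != 0 by rewrite gt_eqF.
  have -> : c / x ^+ 2 = - c *: (- x ^- 2 *: 1).
    by rewrite /GRing.scale/= mulr1 mulrNN.
  apply: is_deriveZ; exact: is_deriveV.
rewrite (@continuous_FTC2 _ _ (fun t : R => - c * t^-1) a b ab).
- by rewrite -EFinB/=; ring.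
- exact: continuous_invsq.
- have cF x : 0 < x -> {for x, continuous (fun t : R => - c * t^-1)}.
    move=> x0; apply: cvgM; first exact: cvg_cst.
    by apply: cvgV; [rewrite gt_eqF|exact: cvg_id].
  split.
  + move=> x; rewrite in_itv/= => /andP[ax _].
    by have [] := dF x (lt_trans a0 ax).
  + by apply: cvg_at_right_filter; apply: cF.
  + by apply: cvg_at_left_filter; apply: cF; rewrite (lt_trans a0).
- move=> x; rewrite in_itv/= => /andP[ax _].
  by rewrite derive1E; have [] := dF x (lt_trans a0 ax).
Qed.

Lemma continuous_divsq (f : R -> R) (a b : R) : 0 < a ->
  {within `[a, b], continuous f} ->
  {within `[a, b], continuous (fun t => f t / t ^+ 2)}.
Proof.
move=> a0 cf.
apply/subspace_continuousP => x xab; apply: cvgM.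
  by move/subspace_continuousP : cf; exact.
have := @continuous_invsq a b 1 a0.
have -> : (fun t : R => 1 / t ^+ 2) = fun t => (t ^+ 2)^-1.
  by apply/funext => t; rewrite mul1r.
by move/subspace_continuousP; exact.
Qed.

Lemma integrable_divsq (f : R -> R) (a b : R) : 0 < a ->
  {within `[a, b], continuous f} ->
  mu.-integrable `[a, b] (EFin \o (fun t => f t / t ^+ 2)).
Proof.
move=> a0 cf; apply: continuous_compact_integrable.
  exact: segment_compact.
exact: continuous_divsq.
Qed.

(** The weight is integrated exactly, so the error comes only from the oscillation of [f] on the
    cell. *)
Lemma Rintegral_divsq_approx (f : R -> R) (a b e : R) : 0 < a -> a < b ->
  {within `[a, b], continuous f} ->
  (forall t, t \in `[a, b] -> `|f t - f a| <= e) ->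
  `|\int[mu]_(t in `[a, b]) (f t / t ^+ 2) - f a * (a^-1 - b^-1)| <=
  e * (a^-1 - b^-1).
Proof.
move=> a0 ab cf fe.
have inv c : mu.-integrable `[a, b] (EFin \o (fun t => c / t ^+ 2)).
  apply: continuous_compact_integrable; first exact: segment_compact.
  exact: continuous_invsq.
rewrite ler_distl -mulrBl -mulrDl -!Rintegral_invsq//.
have t2 t : `[a, b]%classic t -> 0 <= (t ^+ 2)^-1.
  by move=> _; rewrite invr_ge0 sqr_ge0.
apply/andP; split; apply: le_Rintegral => //; try exact: integrable_divsq.
- move=> t tab; apply: ler_wpM2r; first exact: t2.
  by have := fe t tab; rewrite ler_distl => /andP[].
- move=> t tab; apply: ler_wpM2r; first exact: t2.
  by have := fe t tab; rewrite ler_distl => /andP[].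
Qed.

Lemma Rintegral_divsq_split (f : R -> R) (a b c : R) : 0 < a -> a <= b -> b <= c ->
  {within `[a, c], continuous f} ->
  \int[mu]_(t in `[a, c]) (f t / t ^+ 2) =
  \int[mu]_(t in `[a, b]) (f t / t ^+ 2) + \int[mu]_(t in `[b, c]) (f t / t ^+ 2).
Proof.
move=> a0 ab bc cf; apply/eqP; rewrite addrC -subr_eq; apply/eqP.
have ic := integrable_divsq f a c a0 cf.
rewrite Rintegral_itvB//.
rewrite Rintegral_itv_obnd_cbnd//; apply: integrableS ic => //.
by apply: subset_itvr; rewrite bnd_simp.
Qed.

(** The cell errors telescope. Since the weight has mass below 1 on the half-line from 1, the total
    error stays below [e] however many cells there are. *)
Lemma grid_sum_approx (f : R -> R) (rho e : R) (m : nat) : 1 < rho ->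
  {within `[1, rho ^+ m], continuous f} ->
  (forall i t, (i < m)%N -> t \in `[rho ^+ i, rho ^+ i.+1] ->
     `|f t - f (rho ^+ i)| <= e) ->
  `|\int[mu]_(t in `[1, rho ^+ m]) (f t / t ^+ 2) -
    (1 - rho^-1) * \sum_(i < m) (f (rho ^+ i) / rho ^+ i)| <=
  e * (1 - (rho ^+ m)^-1).
Proof.
move=> rho1.
have rho0 : 0 < rho by rewrite (lt_trans _ rho1).
have rX1 i : 1 <= rho ^+ i by rewrite exprn_ege1// ltW.
have rX0 i : 0 < rho ^+ i by exact: exprn_gt0.
have rXS i : rho ^+ i < rho ^+ i.+1 by rewrite exprS ltr_pMl.
elim: m => [|m IH] cf fe.
  by rewrite big_ord0 mulr0 subr0 expr0 invr1 subrr mulr0 set_itv1 Rintegral_set1 normr0.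
have cf1 : {within `[1, rho ^+ m], continuous f}.
  by apply: continuous_subspaceW cf; apply: subset_itvl; rewrite bnd_simp ltW.
have cf2 : {within `[rho ^+ m, rho ^+ m.+1], continuous f}.
  by apply: continuous_subspaceW cf; apply: subset_itvr; rewrite bnd_simp.
have {}IH := IH cf1 (fun i t im => fe i t (ltnW im)).
have h := Rintegral_divsq_approx f (rho ^+ m) (rho ^+ m.+1) e (rX0 m) (rXS m) cf2
  (fun t => fe m t (ltnSn m)).
rewrite (@Rintegral_divsq_split f 1 (rho ^+ m) (rho ^+ m.+1))//; last exact/ltW.
rewrite big_ord_recr/= mulrDr.
have qE : (1 - rho^-1) * (f (rho ^+ m) / rho ^+ m) =
    f (rho ^+ m) * ((rho ^+ m)^-1 - (rho ^+ m.+1)^-1).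
  by rewrite exprS invfM; ring.
rewrite qE.
have -> : 1 - (rho ^+ m.+1)^-1 =
  (1 - (rho ^+ m)^-1) + ((rho ^+ m)^-1 - (rho ^+ m.+1)^-1) by ring.
rewrite [e * _]mulrDr opprD addrACA (le_trans (ler_normD _ _))//.
exact: lerD.
Qed.

Definition geo_ratio (N : R) (m : nat) : R := expR (ln N / m.+1%:R).

Lemma geo_ratio_gt1 N m : 1 < N -> 1 < geo_ratio N m.
Proof.
by move=> N1; rewrite -expR0 ltr_expR divr_gt0// ln_gt0.
Qed.

Lemma geo_ratioX N m : 0 < N -> geo_ratio N m ^+ m.+1 = N.
Proof.
by move=> N0; rewrite -expRM_natl mulrCA divff ?mulr1 ?lnK ?posrE.
Qed.

Lemma cvg_ln_div N : (fun m => ln N / m.+1%:R : R) @ \oo --> (0 : R).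
Proof.
rewrite -[X in _ --> X](mulr0 (ln N)); apply: cvgM; first exact: cvg_cst.
exact: cvg_harmonic.
Qed.

Lemma cvg_geo_ratio N : geo_ratio N @ \oo --> (1 : R).
Proof.
rewrite -[X in _ --> X](@expR0 R); apply: continuous_cvg; last exact: cvg_ln_div.
exact: continuous_expR.
Qed.

Lemma cvg_grid_sum (f : R -> R) (N : R) : 1 < N ->
  {within `[1, N], continuous f} ->
  (fun m => (1 - (geo_ratio N m)^-1) *
     \sum_(i < m.+1) (f (geo_ratio N m ^+ i) / geo_ratio N m ^+ i)) @ \oo -->
  \int[mu]_(t in `[1, N]) (f t / t ^+ 2).
Proof.
move=> N1 cf; have N0 : 0 < N by rewrite (lt_trans _ N1).
apply/cvgrPdist_le => e e0.
have [del del0 Hd] := segment_unif_continuous f 1 N cf e e0.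
have dN : 0 < del / N by rewrite divr_gt0.
near=> m.
have near1 : `|1 - geo_ratio N m| < del / N.
  by near: m; move/cvgrPdist_lt : (cvg_geo_ratio N); exact.
set rho := geo_ratio N m in near1 *.
have rho1 : 1 < rho by exact: geo_ratio_gt1.
have rhoN : rho ^+ m.+1 = N by exact: geo_ratioX.
have rho_near : rho - 1 < del / N by rewrite -[ltLHS]gtr0_norm ?subr_gt0// distrC.
have rho0 : 0 < rho by rewrite (lt_trans _ rho1).
have le_grid i : (i <= m.+1)%N -> 1 <= rho ^+ i <= N.
  move=> im; rewrite exprn_ege1 ?(ltW rho1)//= -rhoN ler_weXn2l// ltW//.
have := @grid_sum_approx f rho e m.+1 rho1; rewrite rhoN => /(_ cf) H.
apply: (le_trans (H _)); last first.
  by rewrite ler_piMr ?(ltW e0)// lerBlDr lerDl invr_ge0 ltW.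
move=> i t im; rewrite in_itv/= => /andP[it ti].
have /andP[r1 rN] := le_grid i (ltnW im).
have /andP[_ rSN] := le_grid i.+1 im.
apply/ltW/Hd; rewrite ?in_itv/= ?r1 ?rN//.
  by rewrite (le_trans r1 it) (le_trans ti rSN).
(* A cell has length [rho ^+ i * (rho - 1)], at most [N * (rho - 1)], which is below [del] for large
   [m]. *)
rewrite ger0_norm ?subr_ge0// (@le_lt_trans _ _ (rho ^+ i * (rho - 1)))//.
  by rewrite mulrBr mulr1 -exprSr lerB.
rewrite (@le_lt_trans _ _ (N * (rho - 1)))//.
  by rewrite ler_wpM2r// subr_ge0 ltW.
by rewrite mulrC -ltr_pdivlMr.
Unshelve. all: end_near. Qed.

End riemann_sums.

(** * Tail probabilities from Laplace transforms *)

Section exponential_tilting.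
Context {R : realType} {d : measure_display} {T : measurableType d}.
Variables (P : probability T R) (L : T -> R).
Hypotheses (mL : measurable_fun setT L) (L0 : forall w, 0 <= L w).

Lemma measurable_sublevel x : measurable [set w | L w <= x].
Proof.
rewrite (_ : [set w | _] = setT `&` L @^-1` [set` `]-oo, x]]); first exact: mL.
by rewrite setTI; apply/seteqP; split => w /=; rewrite in_itv.
Qed.

Let A x := [set w | L w <= x].
Let mA x : measurable (A x). Proof. exact: measurable_sublevel. Qed.

Let Phi lam := \int[P]_w expR (- (lam * L w)).

Lemma integrable_laplace lam : 0 <= lam ->
  P.-integrable setT (EFin \o (fun w => expR (- (lam * L w)))).
Proof.
move=> lam0; apply: (@le_integrable _ _ _ _ _ _ _ (cst 1%E)) => //=.
- apply/measurable_EFinP; apply: measurableT_comp => //.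
  by apply: measurableT_comp => //; exact: measurable_funM.
- move=> w _; rewrite normr1 lee_fin ger0_norm ?expR_ge0//.
  by rewrite -[leRHS]expR0 ler_expR oppr_le0 mulr_ge0.
- exact: finite_measure_integrable_cst.
Qed.

Let iA x : P.-integrable setT (EFin \o \1_(A x)).
Proof. by apply: integrable_indic => //; rewrite fin_num_measure. Qed.

Let RintA x : \int[P]_w \1_(A x) w = fine (P (A x)).
Proof. by rewrite /Rintegral integral_indic// setIT. Qed.

Lemma prob_le_laplace lam x : 0 <= lam ->
  fine (P [set w | L w <= x]) <= expR (lam * x) * Phi lam.
Proof.
move=> lam0; rewrite -[X in X <= _]RintA -RintegralZl//; last exact: integrable_laplace.
apply: le_Rintegral => //.
- by apply: (@integrableZl _ _ _ _ _ measurableT _ _ (integrable_laplace lam lam0)).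
- move=> w _; rewrite -expRD indicE; case: (boolP (w \in A x)) => wA.
    rewrite -[leLHS]expR0 ler_expR -mulrBr mulr_ge0// subr_ge0.
    by move: wA; rewrite inE.
  by rewrite expR_ge0.
Qed.

(** [expR (- (lam * L))] is bounded on three regions. Above [x] it is compared with the exponential
    of parameter [lam0], below [x1] with that of parameter [lam1], and on the remaining window with
    its value at [x1]. *)
Lemma prob_ge_laplace lam0 lam lam1 x1 x : 0 <= lam0 -> lam0 <= lam -> lam <= lam1 ->
  Phi lam - expR (- ((lam - lam0) * x)) * Phi lam0 -
    expR ((lam1 - lam) * x1) * Phi lam1 <=
  expR (- (lam * x1)) * fine (P [set w | L w <= x]).
Proof.
move=> l0 l01 l12.
have l1 : 0 <= lam by lra.
have l2 : 0 <= lam1 by lra.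
rewrite !lerBlDr -[fine _]RintA.
rewrite -!RintegralZl//; try exact: integrable_laplace.
pose i0 := @integrableZl _ _ _ P _ measurableT (expR (- (lam * x1))) _ (iA x).
pose i1 := @integrableZl _ _ _ P _ measurableT (expR ((lam1 - lam) * x1)) _ (integrable_laplace lam1 l2).
pose i2 := @integrableZl _ _ _ P _ measurableT (expR (- ((lam - lam0) * x))) _ (integrable_laplace lam0 l0).
rewrite -!RintegralD//; last exact: (integrableD measurableT i0 i1).
apply: le_Rintegral => //; first exact: integrable_laplace.
  exact: (integrableD measurableT (integrableD measurableT i0 i1) i2).
move=> w _; rewrite -!expRD indicE.
have [xL|Lx] := ltP x (L w).
  have h : expR (- (lam * L w)) <= expR (- ((lam - lam0) * x) + - (lam0 * L w)).
    rewrite ler_expR -subr_ge0 (_ : _ - _ = (lam - lam0) * (L w - x)); last by ring.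
    by rewrite mulr_ge0 ?subr_ge0// ltW.
  apply: (le_trans h); rewrite lerDr addr_ge0 ?expR_ge0// mulr_ge0 ?expR_ge0//.
have wA : w \in A x by rewrite inE.
rewrite wA mulr1.
have [Lx1|x1L] := ltP (L w) x1.
  have h : expR (- (lam * L w)) <= expR ((lam1 - lam) * x1 + - (lam1 * L w)).
    rewrite ler_expR -subr_ge0 (_ : _ - _ = (lam1 - lam) * (x1 - L w)); last by ring.
    by rewrite mulr_ge0 ?subr_ge0// ltW.
  apply: (le_trans h); rewrite -addrA addrCA lerDl addr_ge0 ?expR_ge0//.
have h : expR (- (lam * L w)) <= expR (- (lam * x1)).
  by rewrite ler_expR lerN2 ler_wpM2l.
apply: (le_trans h); rewrite -addrA lerDl addr_ge0 ?expR_ge0//.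
Qed.

End exponential_tilting.

(** * Asymptotics of the mesh *)

Section mesh.
Context {R : realType}.
Variable N : R.
Hypothesis N1 : 1 < N.

Let q m : R := 1 - (geo_ratio N m)^-1.

Lemma cvg_mesh : q @ \oo --> (0 : R).
Proof.
rewrite -[X in _ --> X](subrr 1) -[X in 1 - X]invr1.
apply: cvgB; first exact: cvg_cst.
by apply: cvgV; [rewrite oner_neq0|exact: cvg_geo_ratio].
Qed.

(** With [x = ln N / m.+1%:R], [q m] is [1 - expR (- x)]. This bound and the next come from
    [1 + y <= expR y] at [y = - x] and [y = x]. *)
Lemma mesh_mul_le m : q m * m.+1%:R <= ln N.
Proof.
rewrite -ler_pdivlMr// /q /geo_ratio; set x := ln N / _; rewrite -expRN.
by have := expR_ge1Dx (- x); set y := expR _; lra.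
Qed.

Lemma mesh_mul_ge m : ln N / (1 + ln N / m.+1%:R) <= q m * m.+1%:R.
Proof.
have lN : 0 < ln N by rewrite ln_gt0.
have M0 : 0 < m.+1%:R :> R by rewrite ltr0n.
set x := ln N / m.+1%:R; have x0 : 0 < x by rewrite divr_gt0.
have x1 : 0 < 1 + x by rewrite ltr_pwDl// ltW.
have -> : ln N = x * m.+1%:R by rewrite divfK// gt_eqF.
rewrite mulrAC ler_wpM2r ?(ltW M0)// /q /geo_ratio.
have h : (expR x)^-1 <= (1 + x)^-1.
  by rewrite lef_pV2 ?posrE ?expR_gt0// expR_ge1Dx.
have -> : x / (1 + x) = 1 - (1 + x)^-1 by field; rewrite gt_eqF.
by rewrite -/x; apply: lerB.
Qed.

Lemma cvg_mesh_mul : (fun m => q m * m.+1%:R) @ \oo --> ln N.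
Proof.
apply: (@squeeze_cvgr _ _ _ _ (fun m => ln N / (1 + ln N / m.+1%:R)) (cst (ln N))).
- by apply: nearW => m; rewrite mesh_mul_le mesh_mul_ge.
- rewrite -[X in _ --> X]divr1 -[X in _ / X]addr0.
  apply: cvgM; first exact: cvg_cst.
  apply: cvgV; first by rewrite addr0 oner_neq0.
  apply: cvgD; first exact: cvg_cst.
  exact: cvg_ln_div.
- exact: cvg_cst.
Qed.

End mesh.

(** * Laplace transform of [Lhat], by passage to the limit *)

Section laplace_Lhat.
Context {R : realType} {d : measure_display} {T : measurableType d}.
Variables (P : probability T R) (B : R -> T -> R) (n : nat).
Hypotheses (BM : brownian_motion P B) (n1 : (1 < n)%N).

Let N : R := n%:R.
Let N1 : 1 < N. Proof. by rewrite ltr1n. Qed.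
Let q m : R := 1 - (geo_ratio N m)^-1.
Let Lsum m w : R := q m *
  \sum_(i < m.+1) ((B (geo_ratio N m ^+ i) w) ^+ 2 / geo_ratio N m ^+ i).

Lemma cvg_Lsum w : Lsum ^~ w @ \oo --> Lhat B n w.
Proof.
have [_ _ cB _ _] := BM.
apply: (@cvg_grid_sum R (fun t => (B t w) ^+ 2) N N1).
have := cB w; move/(@continuous_subspaceW _ _ `[1, N]%classic) => /= cB1.
have {}cB1 : {within `[1, N], continuous (fun t => B t w)}.
  apply: cB1 => t /=; rewrite !in_itv/= andbT => /andP[t1 _].
  by rewrite (le_trans _ t1).
apply/subspace_continuousP => x xab; apply: cvgM;
  by move/subspace_continuousP : cB1; exact.
Qed.

Let mLsum m : measurable_fun setT (Lsum m).
Proof.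
have [mB _ _ _ _] := BM.
apply: measurable_funM => //; apply: measurable_sum => i.
by apply: measurable_funM => //; exact: measurable_funX.
Qed.

Lemma measurable_Lhat : measurable_fun setT (Lhat B n).
Proof. by apply: (@measurable_fun_cvg _ _ _ setT Lsum) => // w _; exact: cvg_Lsum. Qed.

Lemma Lhat_ge0 w : 0 <= Lhat B n w.
Proof. by apply: Rintegral_ge0 => t _; rewrite divr_ge0 ?sqr_ge0. Qed.

Let q0 m : 0 < q m.
Proof.
by rewrite subr_gt0 invf_lt1 ?geo_ratio_gt1// (lt_trans ltr01)// geo_ratio_gt1.
Qed.

Let Lsum_ge0 m w : 0 <= Lsum m w.
Proof.
apply: mulr_ge0; first exact: ltW.
by apply: sumr_ge0 => i _; rewrite divr_ge0 ?sqr_ge0// exprn_ge0// expR_ge0.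
Qed.

(** The sums converge along every path and the exponentials lie between 0 and 1, so dominated
    convergence applies. *)
Lemma cvg_laplace_Lsum lam : 0 <= lam ->
  (fun m => grid_laplace P B (geo_ratio N m) lam m.+1 0) @ \oo -->
  (\int[P]_w (expR (- (lam * Lhat B n w)))%:E)%E.
Proof.
move=> lam0.
have -> : (fun m => grid_laplace P B (geo_ratio N m) lam m.+1 0) =
    (fun m => \int[P]_w (expR (- (lam * Lsum m w)))%:E)%E.
  apply/funext => m; apply: eq_integral => w _; congr (expR _)%:E.
  by rewrite !mul0r subr0 /Lsum mulrA.
have [] := @dominated_convergence _ _ _ P setT measurableT
  (fun m w => (expR (- (lam * Lsum m w)))%:E)
  (fun w => (expR (- (lam * Lhat B n w)))%:E) (cst 1%E).
- move=> m; apply/measurable_EFinP; apply: measurableT_comp => //.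
  by apply: measurableT_comp => //; exact: measurable_funM.
- apply/measurable_EFinP; apply: measurableT_comp => //.
  by apply: measurableT_comp => //; apply: measurable_funM => //; exact: measurable_Lhat.
- apply: aeW => w _; apply: cvg_EFin; first exact: nearW.
  apply: continuous_cvg; first exact: continuous_expR.
  by apply: cvgN; apply: cvgM; [exact: cvg_cst|exact: cvg_Lsum].
- exact: finite_measure_integrable_cst.
- apply: aeW => w m _; rewrite /= lee_fin ger0_norm ?expR_ge0//.
  by rewrite -[leRHS]expR0 ler_expR oppr_le0 mulr_ge0.
by move=> _ _.
Qed.

(** The strict inequality leaves room for [g * q m], which tends to 0, so [g] is a supersolution for
    all fine grids; the grid bounds then pass to the limit with [q m * m.+1%:R] tending to
    [ln N]. *)
Lemma laplace_Lhat_sandwich lam g : 0 <= lam -> 0 <= g -> 2 * lam < g * (1 + g) ->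
  (((Num.sqrt (1 + g))^-1 * expR (- (g * ln N / 2)))%:E <=
   \int[P]_w (expR (- (lam * Lhat B n w)))%:E <=
   (expR (- ((2 * lam * ln N - g) / (2 * (1 + g)))))%:E)%E.
Proof.
move=> lam0 g0 gs.
have g1 : 0 < 1 + g by rewrite ltr_pwDl.
have c1 : (fun m => 1 + g * q m) @ \oo --> (1 : R).
  rewrite [X in _ --> X](_ : 1 = 1 + g * 0); last by rewrite mulr0 addr0.
  apply: cvgD; first exact: cvg_cst.
  by apply: cvgM; [exact: cvg_cst|exact: cvg_mesh].
have q_near : \forall m \near \oo, 2 * lam * (1 + g * q m) <= g * (1 + g).
  have /cvgrPdist_lt/(_ (g * (1 + g) - 2 * lam)) :
      (fun m => 2 * lam * (1 + g * q m)) @ \oo --> 2 * lam.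
    by rewrite -[X in _ --> X]mulr1; apply: cvgM; [exact: cvg_cst|exact: c1].
  rewrite subr_gt0 => /(_ gs); apply: filterS => m.
  by rewrite distrC => /(le_lt_trans (ler_norm _)); lra.
apply/andP; split.
  apply: (cvge_to_ge (cvg_laplace_Lsum _ lam0)).
  near=> m.
  apply: le_trans (@grid_laplace_ge _ _ _ P B _ lam BM _ lam0 m.+1 g g0 _).
  - rewrite lee_fin ler_wpM2l ?invr_ge0 ?sqrtr_ge0// ler_expR lerN2.
    rewrite ler_wpM2r// -mulrA ler_wpM2l//; exact: mesh_mul_le.
  - exact: geo_ratio_gt1.
  - by near: m.
have cU : (fun m => (expR (- ((2 * lam * q m * m.+1%:R - g) /
      (2 * (1 + g) * (1 + g * q m)))))%:E) @ \oo -->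
    (expR (- ((2 * lam * ln N - g) / (2 * (1 + g)))))%:E.
  apply: cvg_EFin; first exact: nearW.
  apply: continuous_cvg; first exact: continuous_expR.
  apply: cvgN; apply: cvgM.
    apply: cvgB; last exact: cvg_cst.
    under eq_fun do rewrite -mulrA.
    by apply: cvgM; [exact: cvg_cst|exact: cvg_mesh_mul].
  apply: cvgV; first by rewrite mulf_neq0// gt_eqF.
  by rewrite -[X in _ --> X]mulr1; apply: cvgM; [exact: cvg_cst|exact: c1].
apply: (lee_cvg_to (cvg_laplace_Lsum _ lam0) cU).
near=> m; apply: (@grid_laplace_le _ _ _ P B _ lam BM _ lam0 m.+1 g g0).
- exact: geo_ratio_gt1.
- by near: m.
Unshelve. all: end_near. Qed.

Definition laplace_Lhat b : R :=
  \int[P]_w expR (- (b * (1 + b) / 2 * Lhat B n w)).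

(* The fixed point b of the Riccati flow is perturbed to g = b + 1 / ln n, at the
   price of a bounded factor. *)
Lemma laplace_Lhat_bounds b : 0 <= b -> 1 <= ln N ->
  expR (- (1 + b) - b * ln N / 2) <= laplace_Lhat b <=
  expR (1 + b - b * ln N / 2).
Proof.
move=> b0 T1; set t := ln N in T1 *.
have t0 : 0 < t by rewrite (lt_le_trans ltr01).
have lam0 : 0 <= b * (1 + b) / 2 by rewrite divr_ge0// mulr_ge0// addr_ge0.
pose u := t^-1; have u0 : 0 < u by rewrite invr_gt0.
have u1 : u <= 1 by rewrite invf_le1.
have ut : u * t = 1 by rewrite mulVf// gt_eqF.
have g0 : 0 <= b + u by rewrite addr_ge0// ltW.
have gs : 2 * (b * (1 + b) / 2) < (b + u) * (1 + (b + u)) by nra.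
have := laplace_Lhat_sandwich _ _ lam0 g0 gs.
rewrite -[X in (_ <= X <= _)%E]fineK; last first.
  apply: integrable_fin_num => //.
  exact: (integrable_laplace _ _ measurable_Lhat Lhat_ge0).
rewrite !lee_fin -/t -/(laplace_Lhat b) => /andP[h1 h2].
apply/andP; split; [apply: le_trans h1|apply: (le_trans h2)].
  have g1 : 0 < 1 + (b + u) by rewrite ltr_pwDl.
  have s1 : expR (- ((1 + b) / 2)) <= (Num.sqrt (1 + (b + u)))^-1.
    rewrite expRN lef_pV2 ?posrE ?sqrtr_gt0 ?expR_gt0//.
    rewrite -[leRHS]ger0_norm ?expR_ge0// -sqrtr_sqr ler_wsqrtr//.
    rewrite -expRM_natl mulrC divfK// (le_trans _ (expR_ge1Dx _))//; lra.
  have e1 : - (1 + b) - b * t / 2 <= - ((1 + b) / 2) + (- ((b + u) * t / 2)).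
    by rewrite [(b + u) * t]mulrDl ut; lra.
  apply: (@le_trans _ _ (expR (- ((1 + b) / 2) + - ((b + u) * t / 2)))).
    by rewrite ler_expR.
  by rewrite expRD ler_wpM2r ?expR_ge0.
rewrite ler_expR -mulNr ler_pdivrMr; last by rewrite mulr_gt0// ltr_pwDl.
rewrite -subr_ge0 (_ : _ - _ = 2 + 2 * b + u + 2 * b ^+ 2 + 2 * b * u +
    b * (1 - u * t)); last by field.
rewrite ut subrr mulr0 addr0 !addr_ge0 ?mulr_ge0 ?sqr_ge0//; exact: ltW.
Qed.

End laplace_Lhat.

(** * Upper and lower bounds for the tail probability *)

Section lower_tail.
Context {R : realType} {d : measure_display} {T : measurableType d}.
Variables (P : probability T R) (B : R -> T -> R) (n : nat) (c : R).
Hypotheses (BM : brownian_motion P B) (n1 : (1 < n)%N) (c01 : 0 < c <= 1).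

Let t : R := ln n%:R.
Let p : R := fine (P [set w | Lhat B n w <= c * t]).
Hypothesis t1 : 1 <= t.

(** The minimiser of the Markov exponent [c * b * (1 + b) / 2 - b / 2]. The identity [cb0] is the
    stationarity condition, and the minimum is [- Krate c]. *)
Let b0 := (1 - c) / (2 * c).
Let c0 : 0 < c. Proof. by case/andP: c01. Qed.
Let b00 : 0 <= b0.
Proof. by rewrite divr_ge0 ?subr_ge0 ?mulr_ge0 ?(ltW c0)//; case/andP: c01. Qed.
Let cb0 : c * (1 + 2 * b0) = 1.
Proof. by rewrite /b0; field; rewrite gt_eqF. Qed.
Let KrateE : Krate c = c * b0 ^+ 2 / 2.
Proof. by rewrite /Krate /b0; field; rewrite gt_eqF. Qed.

Lemma Lhat_tail_le : p <= expR (1 + b0 - Krate c * t).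
Proof.
pose lam := b0 * (1 + b0) / 2.
have lam0 : 0 <= lam by rewrite divr_ge0// mulr_ge0// addr_ge0.
apply: le_trans (prob_le_laplace P _ (measurable_Lhat _ _ _ BM n1) (Lhat_ge0 B n)
  lam (c * t) lam0) _.
have /andP[_ h] := laplace_Lhat_bounds P B n BM n1 b0 b00 t1.
apply: le_trans (ler_wpM2l (expR_ge0 _) h) _.
rewrite -expRD ler_expR KrateE /lam -/t.
rewrite le_eqVlt; apply/orP; left; apply/eqP.
(* The surplus is isolated as a multiple of [c * (1 + 2 * b0) - 1], which vanishes by [cb0]. *)
have -> : b0 * (1 + b0) / 2 * (c * t) + (1 + b0 - b0 * t / 2) =
  1 + b0 - c * b0 ^+ 2 / 2 * t + b0 * t / 2 * (c * (1 + 2 * b0) - 1) by field.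
by rewrite cb0 subrr mulr0 addr0.
Qed.

(** Tilting at [b0 + s] favours values of [Lhat] between [c1 * t] and [c * t], the levels optimal
    for [b0 + 2 * s] and [b0]. Comparison with these two parameters makes both outer parts smaller
    by [expR (- (c1 * s ^+ 2 * t / 2))], up to constants; the size condition on [t] then makes them
    negligible. *)
Lemma Lhat_tail_ge s : 0 < s ->
  4 + 2 * b0 + 3 * s <= s ^+ 2 / (2 * (1 + 2 * (b0 + 2 * s))) * t ->
  expR (- (2 + b0 + s) - (Krate c + c * s * (4 * b0 + 3 * s) / 2) * t) <= p.
Proof.
move=> s0 large.
have e2 : 2 <= expR 1 :> R by apply: le_trans (expR_ge1Dx 1); lra.
pose b := b0 + s; pose b1 := b0 + 2 * s.
have b_0 : 0 <= b by rewrite /b addr_ge0// ltW.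
have b10 : 0 <= b1 by rewrite /b1 addr_ge0// mulr_ge0// ltW.
pose c1 := (1 + 2 * b1)^-1.
have v0 : 0 < 1 + 2 * b1 by rewrite ltr_pwDl// mulr_ge0.
have c10 : 0 < c1 by rewrite invr_gt0.
have cb1 : c1 * (1 + 2 * b1) = 1 by rewrite mulVf// gt_eqF.
have c1c : c1 <= c.
  rewrite -(ler_pM2r v0) cb1; apply: (@le_trans _ _ (c * (1 + 2 * b0))).
    by rewrite cb0.
  by rewrite ler_pM2l// /b1; lra.
have t0 : 0 < t by rewrite (lt_le_trans ltr01).
have s2t : 0 <= s ^+ 2 * t by rewrite mulr_ge0 ?sqr_ge0// ltW.
have {}large : 4 + b + b1 <= c1 * s ^+ 2 / 2 * t.
  apply: le_trans (_ : _ <= 4 + 2 * b0 + 3 * s) _; first by rewrite /b /b1; lra.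
  apply: (le_trans large); rewrite le_eqVlt; apply/orP; left; apply/eqP.
  by rewrite /c1 /b1; field; rewrite gt_eqF.
pose l (x : R) := x * (1 + x) / 2.
have l0 x : 0 <= x -> 0 <= l x.
  by move=> x0; rewrite divr_ge0// mulr_ge0// addr_ge0.
have l01 : l b0 <= l b.
  rewrite -subr_ge0 (_ : _ - _ = s * (1 + 2 * b0 + s) / 2); last by rewrite /l /b; field.
  by apply: divr_ge0 => //; apply: mulr_ge0; [exact: ltW|move: b00 s0; lra].
have l12 : l b <= l b1.
  rewrite -subr_ge0 (_ : _ - _ = s * (1 + 2 * b0 + 3 * s) / 2); last by rewrite /l /b /b1; field.
  by apply: divr_ge0 => //; apply: mulr_ge0; [exact: ltW|move: b00 s0; lra].
have := prob_ge_laplace P _ (measurable_Lhat _ _ _ BM n1) (Lhat_ge0 B n)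
  (l b0) (l b) (l b1) (c1 * t) (c * t) (l0 _ b00) l01 l12.
rewrite -/p -!/(laplace_Lhat P B n _).
have /andP[h _] := laplace_Lhat_bounds P B n BM n1 b b_0 t1.
have /andP[_ h0] := laplace_Lhat_bounds P B n BM n1 b0 b00 t1.
have /andP[_ h1] := laplace_Lhat_bounds P B n BM n1 b1 b10 t1.
rewrite -/t in h h0 h1.
(* [E] is the lower bound for the transform at [b] divided by [expR 1]. As [expR 1] is at least 2,
   the transform is at least [2 * E]; the outer parts take at most [E / 2] each, leaving [E] for the
   window. *)
set E := expR (- b * t / 2 - (2 + b)).
have E0 : expR (- ((l b - l b0) * (c * t))) * laplace_Lhat P B n b0 <= E / 2.
  apply: le_trans (ler_wpM2l (expR_ge0 _) h0) _.
  rewrite -expRD ler_pdivlMr//.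
  apply: le_trans (ler_wpM2l (expR_ge0 _) e2) _.
  rewrite -expRD ler_expR.
  have -> : - ((l b - l b0) * (c * t)) + (1 + b0 - b0 * t / 2) + 1 =
    2 + b0 - b * t / 2 - c * (s ^+ 2 * t) / 2 - s * t / 2 * (c * (1 + 2 * b0) - 1).
    by rewrite /l /b; field.
  rewrite cb0 subrr mulr0 subr0.
  have : c1 * (s ^+ 2 * t) <= c * (s ^+ 2 * t) by rewrite ler_wpM2r.
  by move: large; rewrite /b1 /b; lra.
have E1 : expR ((l b1 - l b) * (c1 * t)) * laplace_Lhat P B n b1 <= E / 2.
  apply: le_trans (ler_wpM2l (expR_ge0 _) h1) _.
  rewrite -expRD ler_pdivlMr//.
  apply: le_trans (ler_wpM2l (expR_ge0 _) e2) _.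
  rewrite -expRD ler_expR.
  have -> : (l b1 - l b) * (c1 * t) + (1 + b1 - b1 * t / 2) + 1 =
    2 + b1 - b * t / 2 - c1 * (s ^+ 2 * t) / 2 + s * t / 2 * (c1 * (1 + 2 * b1) - 1).
    by rewrite /l /b /b1; field.
  rewrite cb1 subrr mulr0 addr0.
  by move: large; rewrite /b1 /b; lra.
have Eb : 2 * E <= laplace_Lhat P B n b.
  apply: le_trans h; apply: (@le_trans _ _ (expR 1 * E)).
    by rewrite ler_wpM2r ?expR_ge0.
  by rewrite -expRD ler_expR; lra.
move=> H.
have {}H : E <= expR (- (l b * (c1 * t))) * p by move: H E0 E1 Eb; lra.
have {}H : expR (l b * (c1 * t)) * E <= p.
  by rewrite mulrC -ler_pdivlMr ?expR_gt0// -expRN mulrC.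
apply: le_trans H; rewrite -expRD ler_expR KrateE.
(* By [cb1] the exponent reduces to a quadratic in [s]; replacing [c1] by the larger [c] gives
   [Krate c] plus an error of order [s]. *)
have -> : l b * (c1 * t) + (- b * t / 2 - (2 + b)) =
  - (2 + b) - c1 * ((b0 + s) * (b0 + 3 * s) * t) / 2 +
    b * t / 2 * (c1 * (1 + 2 * b1) - 1) by rewrite /l /b1 /b; field.
rewrite cb1 subrr mulr0 addr0.
have : c1 * ((b0 + s) * (b0 + 3 * s) * t) <= c * ((b0 + s) * (b0 + 3 * s) * t).
  by rewrite ler_wpM2r// !mulr_ge0 ?(ltW t0)//; move: b00 s0; lra.
rewrite /b; lra.
Qed.

End lower_tail.

(** * The exponent of the tail probability *)

Lemma ln_nat_near_ge (R : realType) (M : R) : \forall n \near \oo, M <= ln (n%:R : R).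
Proof.
near=> n.
have h : expR M <= n%:R by near: n; exact: nbhs_infty_ger.
by rewrite -[leLHS]expRK ler_ln ?posrE ?expR_gt0// (lt_le_trans (expR_gt0 M)).
Unshelve. all: end_near. Qed.

Theorem mainTheorem17 (R : realType) (d : measure_display) (T : measurableType d)
    (P : probability T R) (B : R -> T -> R) (c : R) :
  brownian_motion P B -> 0 < c <= 1 ->
  exists eps : nat -> R, eps @ \oo --> 0 /\
    \forall n \near \oo,
      P [set w | Lhat B n w <= c * ln n%:R] = ((n%:R) `^ (- Krate c + eps n))%:E.
Proof.
move=> BM c01; have /andP[c0 c1] := c01.
pose p n : R := fine (P [set w | Lhat B n w <= c * ln n%:R]).
pose b0 := (1 - c) / (2 * c).
have b00 : 0 <= b0 by rewrite divr_ge0 ?subr_ge0 ?mulr_ge0// ltW.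
have lower e : 0 < e -> \forall n \near \oo, expR (- (Krate c + e) * ln n%:R) <= p n.
  (* The bound [s <= 1] replaces [3 * s] by 3, and the second term of the minimum then keeps the
     loss in the rate below [e / 2]. *)
  move=> e0; pose s := Num.min 1 (e / (4 * b0 + 3)).
  have w0 : 0 < 4 * b0 + 3 by rewrite ltr_wpDl// mulr_ge0.
  have s0 : 0 < s by rewrite lt_min ltr01 divr_gt0.
  have s1 : s <= 1 by rewrite ge_min lexx.
  have se : s * (4 * b0 + 3) <= e by rewrite -ler_pdivlMr// ge_min lexx orbT.
  have rate : c * s * (4 * b0 + 3 * s) / 2 <= e / 2.
    rewrite ler_pM2r// (le_trans _ se)// -mulrA -[leRHS]mul1r.
    have h : 4 * b0 + 3 * s <= 4 * b0 + 3 by lra.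
    apply: ler_pM => //; [exact: ltW| |by rewrite ler_pM2l].
    by rewrite mulr_ge0 ?(ltW s0)//; lra.
  pose k := s ^+ 2 / (2 * (1 + 2 * (b0 + 2 * s))).
  have k0 : 0 < k.
    rewrite divr_gt0 ?exprn_gt0// mulr_gt0// ltr_pwDl// mulr_ge0// addr_ge0//.
    by rewrite mulr_ge0// ltW.
  near=> n; pose t : R := ln n%:R.
  have n1 : (1 < n)%N by near: n; exact: nbhs_infty_gt.
  have t1 : 1 <= t by rewrite /t; near: n; exact: ln_nat_near_ge.
  (* [t2] is the size condition of [Lhat_tail_ge]; [t3] absorbs its constant factor into the other
     [e / 2]. *)
  have t2 : (4 + 2 * b0 + 3 * s) / k <= t by rewrite /t; near: n; exact: ln_nat_near_ge.
  have t3 : (2 + b0 + s) / (e / 2) <= t by rewrite /t; near: n; exact: ln_nat_near_ge.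
  have t0 : 0 < t by rewrite (lt_le_trans ltr01).
  apply: le_trans (Lhat_tail_ge P B n c BM n1 c01 t1 s s0 _); last first.
    by rewrite -/t -/b0 -/k [k * t]mulrC -ler_pdivrMr.
  rewrite ler_expR -/t -/b0.
  have h3 : 2 + b0 + s <= e / 2 * t by rewrite [_ * t]mulrC -ler_pdivrMr ?divr_gt0.
  have h4 : c * s * (4 * b0 + 3 * s) / 2 * t <= e / 2 * t by rewrite ler_wpM2r// ltW.
  by lra.
(* The claimed equation solved for [eps n]. It is meaningful once [ln n%:R] and [p n] are positive,
   which holds for large [n]. *)
exists (fun n => Krate c + ln (p n) / ln n%:R); split.
  apply/cvgrPdist_le => e e0.
  near=> n; pose t : R := ln n%:R.
  have n1 : (1 < n)%N by near: n; exact: nbhs_infty_gt.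
  have t1 : 1 <= t by rewrite /t; near: n; exact: ln_nat_near_ge.
  have t2 : (1 + b0) / e <= t by rewrite /t; near: n; exact: ln_nat_near_ge.
  have low : expR (- (Krate c + e) * t) <= p n by rewrite /t; near: n; exact: lower.
  have t0 : 0 < t by rewrite (lt_le_trans ltr01).
  have up := Lhat_tail_le P B n c BM n1 c01 t1.
  rewrite -/(p n) -/t -/b0 in up.
  have p0 : 0 < p n by rewrite (lt_le_trans (expR_gt0 _) low).
  rewrite sub0r normrN ler_norml; apply/andP; split.
    rewrite -lerBlDl -opprD [e + _]addrC ler_pdivlMr// -[leLHS]expRK.
    by rewrite ler_ln ?posrE ?expR_gt0.
  rewrite -lerBrDl ler_pdivrMr//.
  apply: (@le_trans _ _ (1 + b0 - Krate c * t)).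
    by rewrite -[leRHS]expRK ler_ln ?posrE ?expR_gt0.
  by rewrite mulrBl lerD2r [e * t]mulrC -ler_pdivrMr.
near=> n.
have n1 : (1 < n)%N by near: n; exact: nbhs_infty_gt.
(* Any fixed loss would do; 1 is taken to get [p n > 0], so that [lnK] applies. *)
have low : expR (- (Krate c + 1) * ln n%:R) <= p n by near: n; exact: lower.
have p0 : 0 < p n by rewrite (lt_le_trans (expR_gt0 _) low).
have n0 : (n%:R : R) != 0 by rewrite pnatr_eq0 -lt0n ltnW.
have t0 : 0 < ln (n%:R : R) by rewrite ln_gt0// ltr1n.
rewrite addKr /powR (negbTE n0) divfK ?gt_eqF// lnK ?posrE// /p fineK//.
by rewrite fin_num_measure//; apply/measurable_sublevel/(measurable_Lhat P).
Unshelve. all: end_near. Qed.
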